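(* For every integer $\ell\ge 1$, the outer multiset dimension of the full $2$-ary tree $T_\ell^2$ of depth $\ell$ is $$\dim_{ms}(T_\ell^2)=\begin{cases}1,&\text{if }\ell=1\\3,&\text{if }\ell=2\\6,&\text{if }\ell=3\\13,&\text{if }\ell=4\\2^{\ell-4}\times 13,&\text{otherwise.}\end{cases}$$
   Context: For a simple connected graph $G=(V,E)$, $d_G(u,v)$ is the length of a shortest $u$–$v$ path. For $S=\{w_1,\ldots,w_t\}\subseteq V$ and $u\in V$, the multiset representation of $u$ with respect to $S$ is the multiset $\operatorname{m}(u|S)$ consisting of $d_G(u,w_1),\ldots,d_G(u,w_t)$, counted with multiplicity. A set $S\subseteq V$ is an outer multiset resolving set of $G$ if $\operatorname{m}(u|S)\ne \operatorname{m}(v|S)$ for every two distinct vertices $u,v\in V\setminus S$. The outer multiset dimension $\dim_{ms}(G)$ is the minimum cardinality of an outer multiset resolving set of $G$. A full $\delta$-ary tree is a rooted tree whose root has degree $\delta$, all of whose leaves are at the same distance from the root (this distance is the depth), and in which every vertex other than the root is either a leaf or a vertex of degree $\delta+1$. *)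

(* Defs.v *)
From mathcomp Require Import all_boot.
From mathcomp Require Import finmap multiset.

Set Implicit Arguments.
Unset Strict Implicit.
Unset Printing Implicit Defensive.

Local Open Scope mset_scope.

Definition simple_graph (T : finType) (e : rel T) : Prop :=
  symmetric e /\ irreflexive e.

Definition connected_graph (T : finType) (e : rel T) : Prop :=
  forall u v : T, connect e u v.

(* A cycle of a graph has at least three vertices; the bound on the size rules
   out the degenerate [ucycle]s [::] and [:: u; v] with u, v adjacent. *)
Definition acyclic_graph (T : finType) (e : rel T) : Prop :=
  forall c : seq T, ucycle e c -> size c <= 2.

Definition tree (T : finType) (e : rel T) : Prop :=
  [/\ simple_graph e, connected_graph e & acyclic_graph e].

Definition degree (T : finType) (e : rel T) (u : T) : nat :=
  #|[set v | e u v]|.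

Definition has_path_of_length (T : finType) (e : rel T) (u v : T) (n : nat)
    : bool :=
  [exists p : n.-tuple T, [&& path e u p, uniq (u :: p) & last u p == v]].

(* A path has fewer than #|T| edges, so the search range is exhaustive; the
   value is #|T| when v is not reachable from u. *)
Definition gdist (T : finType) (e : rel T) (u v : T) : nat :=
  find (has_path_of_length e u v) (iota 0 #|T|).

Definition mrep (T : finType) (e : rel T) (S : {set T}) (u : T) : {mset nat} :=
  seq_mset [seq gdist e u w | w <- enum S].

Definition outer_ms_resolving (T : finType) (e : rel T) (S : {set T}) : bool :=
  [forall u, forall v,
    [&& u \notin S, v \notin S & u != v] ==> (mrep e S u != mrep e S v)].

(* [set: T] is vacuously resolving, so the minimum is over a nonempty family. *)
Definition dim_ms (T : finType) (e : rel T) : nat :=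
  #|[arg min_(S < [set: T] | outer_ms_resolving e S) #|S|]|.

(* The root does not count as a leaf, even when it has degree 1. *)
Definition leaf (T : finType) (e : rel T) (r v : T) : Prop :=
  v <> r /\ degree e v = 1.

Definition full_ary_tree (d l : nat) (T : finType) (e : rel T) (r : T) : Prop :=
  [/\ tree e,
      degree e r = d,
      forall v, leaf e r v -> gdist e r v = l
    & forall v, v <> r -> leaf e r v \/ degree e v = d.+1].

(* Main.v *)
Require Import Defs.
From mathcomp Require Import all_boot.
From mathcomp Require Import finmap multiset zify.

Set Implicit Arguments.
Unset Strict Implicit.
Unset Printing Implicit Defensive.

(** In a tree simple paths are unique. Hence a vertex is the same as a word, the
sequence of child indices met on the way from the root, and the distance of two
vertices is the sum of the lengths of the two words after removing their common
prefix. For the full [d]-ary tree of depth [l] the words are those of length at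
most [l] over the letters [0, ..., d - 1].

Lower bound: if two siblings are outside a resolving set, then their branches
must have different numbers of selected vertices on some level, since everything
outside the two branches is equidistant from both siblings. For [d = 2], applied
from the leaves upwards, this forces 1, 3 and 6 selected vertices in branches of
depth 1, 2 and 3. A set of size 6 at depth 3 must have level counts (0, 0, 1, 5),
so two such branches cannot be siblings and depth 4 needs 13 vertices; from there
on the bound doubles.

Upper bound: vertices of different depths are separated by their largest
distance to a selected leaf. For vertices of equal depth, resolving sets with
pairwise different numbers of leaves can be placed in the branches of the root.
If [d + 1] consecutive leaf counts occur at one depth, then omitting each of them
in turn and adding up the others gives [d + 1] consecutive leaf counts one level
up. For [d = 2] and depth 4 there are resolving sets of size 13 with 9, 10 and 11
leaves. *)

(** * Distances in acyclic graphs *)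

Lemma last_rev_belast (T : Type) (x : T) p :
  last (last x p) (rev (belast x p)) = x.
Proof. by case: p => //= y p; rewrite rev_cons last_rcons. Qed.

Definition simple_path (T : eqType) (e : rel T) (x : T) (p : seq T) : bool :=
  path e x p && uniq (x :: p).

Lemma simple_path_cons (T : eqType) (e : rel T) x y p :
  simple_path e x (y :: p) = [&& e x y, x \notin y :: p & simple_path e y p].
Proof. by rewrite /simple_path /= -andbA [X in _ && X]andbCA. Qed.

Lemma simple_path_prefix (T : eqType) (e : rel T) x p q :
  simple_path e x (p ++ q) -> simple_path e x p.
Proof.
rewrite /simple_path cat_path -cat_cons cat_uniq.
by move=> /andP[/andP[-> _] /andP[->]].
Qed.

Section AcyclicGraph.

Variables (T : finType) (e : rel T).
Hypotheses (e_sym : symmetric e) (e_acyclic : acyclic_graph e).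

Lemma sym_rev_path x p : path e (last x p) (rev (belast x p)) = path e x p.
Proof. by rewrite rev_path; apply: eq_path => y z; apply: e_sym. Qed.

Lemma simple_path_closed x p :
  simple_path e x p -> e (last x p) x -> size p <= 1.
Proof.
move=> /andP[ep up] ex; apply: (e_acyclic (c := x :: p)).
by rewrite /ucycle /= rcons_path ep ex.
Qed.

Lemma simple_path_inj x p q :
  simple_path e x p -> simple_path e x q -> last x p = last x q -> p = q.
Proof.
elim: p x q => [|a p IHp] x [|b q] // sp sq.
- by case/and3P: sq => _ xq _ /= xE; rewrite [X in X \in _]xE mem_last in xq.
- by case/and3P: sp => _ xp _ /= xE; rewrite -[X in X \in _]xE mem_last in xp.
rewrite simple_path_cons in sp; rewrite simple_path_cons in sq.
case/and3P: sp sq => exa xp sp /and3P[exb xq sq].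
have [eq_ab | neq_ab] := eqVneq a b => /= lastE.
  by rewrite -{}eq_ab in sq lastE *; congr (_ :: _); apply: IHp lastE.
have [/andP[ep _] /andP[eq _]] := (sp, sq).
have walk_ab : path e a (p ++ rev (belast b q)).
  by rewrite cat_path ep lastE sym_rev_path.
have last_ab : last a (p ++ rev (belast b q)) = b.
  by rewrite last_cat lastE last_rev_belast.
case/shortenP: walk_ab last_ab => w ew uw sub_w last_w.
have xw : x \notin a :: w.
  move: xp xq; rewrite !inE !negb_or => /andP[-> xp] /andP[xb xq] /=.
  apply/negP => /sub_w; rewrite mem_cat mem_rev (negPf xp) /= => /mem_belast.
  by rewrite inE (negPf xb) (negPf xq).
have : size (a :: w) <= 1.
  apply: (@simple_path_closed x); last by rewrite /= last_w e_sym.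
  by rewrite /simple_path /= exa ew xw.
by case: (w) last_w neq_ab => //= ->; rewrite eqxx.
Qed.

Lemma simple_path_disjoint x a b p q :
    simple_path e x (a :: p) -> simple_path e x (b :: q) -> a != b ->
  ~~ has [in a :: p] (b :: q).
Proof.
move=> sp sq; apply: contra => /hasP[z zq zp].
have prefix_to s : simple_path e x s -> z \in s ->
    exists s' s'', [/\ s = rcons s' z ++ s'' & simple_path e x (rcons s' z)].
  move=> + zs; case/path.splitP: zs => s' s'' ss.
  by exists s', s''; split=> //; apply: simple_path_prefix ss.
have [p' [p'' [pE sp']]] := prefix_to _ sp zp.
have [q' [q'' [qE sq']]] := prefix_to _ sq zq.
have pq : rcons p' z = rcons q' z.
  by apply: simple_path_inj sp' sq' _; rewrite !last_rcons.
by move: pE qE; rewrite pq; case: (q') => [|c s] /= [-> _] [-> _].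
Qed.

Lemma gdist_simple_path x p :
  simple_path e x p -> gdist e x (last x p) = size p.
Proof.
move=> sp; have /andP[ep up] := sp; rewrite /gdist.
have lt_p : size p < #|T|.
  by rewrite -[(size p).+1]/(size (x :: p)) -(card_uniqP up) max_card.
rewrite (eq_find (a2 := pred1 (size p))) => [|n].
  have pE : nth 0 (iota 0 #|T|) (size p) = size p by rewrite nth_iota.
  by rewrite -/(index _ _) -{1}pE index_uniq ?size_iota ?iota_uniq.
apply/existsP/eqP => [[q /and3P[eq uq /eqP lastE]]|->].
  rewrite -(simple_path_inj _ sp lastE) ?size_tuple //.
  by rewrite /simple_path eq uq.
by exists (in_tuple p); rewrite /= ep eqxx andbT.
Qed.

Lemma gdist_disjoint_paths x p q :
    simple_path e x p -> simple_path e x q -> ~~ has [in p] q ->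
  gdist e (last x p) (last x q) = size p + size q.
Proof.
move=> /andP[ep up] /andP[eq]; rewrite cons_uniq => /andP[xq uq] disj_pq.
have lastE : last x q = last (last x p) (rev (belast x p) ++ q).
  by rewrite last_cat last_rev_belast.
rewrite lastE gdist_simple_path ?size_cat ?size_rev ?size_belast //.
rewrite /simple_path cat_path last_rev_belast sym_rev_path ep eq.
rewrite -cat_cons -rev_rcons -lastI cat_uniq rev_uniq up /= uq andbT.
apply/hasPn => z zq; rewrite mem_rev inE negb_or (hasPn disj_pq z zq) andbT.
by apply: contraNneq xq => <-.
Qed.

End AcyclicGraph.

(** * The vertices of a rooted tree as words *)

Fixpoint word_dist (A : eqType) (u v : seq A) : nat :=
  match u, v with
  | a :: u', b :: v' => if a == b then word_dist u' v' else size u + size v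
  | _, _ => size u + size v
  end.

Lemma word_dist_le (A : eqType) (u v : seq A) : word_dist u v <= size u + size v.
Proof.
elim: u v => [|a u IHu] [|b v] //=; case: eqP => // _.
by have := IHu v; lia.
Qed.

Lemma word_dist_eq0 (A : eqType) (u v : seq A) : (word_dist u v == 0) = (u == v).
Proof.
elim: u v => [|a u IHu] [|b v] //=; rewrite eqseq_cons.
by case: (eqVneq a b).
Qed.

Section Addresses.

Variables (T : finType) (e : rel T) (r : T).
Hypothesis e_tree : tree e.

Let e_sym : symmetric e. Proof. by case: e_tree => -[]. Qed.
Let e_irr : irreflexive e. Proof. by case: e_tree => -[]. Qed.
Let e_connected : connected_graph e. Proof. by case: e_tree. Qed.
Let e_acyclic : acyclic_graph e. Proof. by case: e_tree. Qed.

(* A position is a pair (parent, vertex); the root is its own parent, which by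
   irreflexivity excludes none of its neighbours from its children. *)
Implicit Types (a : T * T) (s t : seq nat).

Definition children a : seq T := enum [set z | e a.2 z & z != a.1].

Definition descend a (i : nat) : T * T := (a.2, nth a.2 (children a) i).

Fixpoint address a s : bool :=
  if s is i :: s' then (i < size (children a)) && address (descend a i) s'
  else true.

Definition position s : T * T := foldl descend (r, r) s.

Definition vertex s : T := (position s).2.

Definition trail a s : seq T := unzip2 (scanl descend a s).

Lemma mem_children a z : (z \in children a) = e a.2 z && (z != a.1).
Proof. by rewrite mem_enum inE. Qed.

Lemma descend_children a i :
  i < size (children a) -> (descend a i).2 \in children a.
Proof. exact: mem_nth. Qed.

Lemma address_cons a i s :
  address a (i :: s) = (i < size (children a)) && address (descend a i) s.
Proof. by []. Qed.

Lemma address_rcons a s i :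
  address a (rcons s i) =
  address a s && (i < size (children (foldl descend a s))).
Proof. by elim: s a => [|j s IHs] a /=; rewrite ?andbT ?IHs ?andbA. Qed.

Lemma size_trail a s : size (trail a s) = size s.
Proof. by rewrite size_map size_scanl. Qed.

Lemma trail_cons a i s :
  trail a (i :: s) = (descend a i).2 :: trail (descend a i) s.
Proof. by []. Qed.

Lemma trail_rcons a s i :
  trail a (rcons s i) = rcons (trail a s) (descend (foldl descend a s) i).2.
Proof. by rewrite /trail /unzip2 scanl_rcons map_rcons foldl_rcons. Qed.

Lemma last_trail a s : last a.2 (trail a s) = (foldl descend a s).2.
Proof. by case/lastP: s => // s i; rewrite trail_rcons last_rcons foldl_rcons. Qed.

(* A walk in an acyclic graph that never goes straight back is simple. *)
Lemma trail_simple a s : address a s -> simple_path e a.2 (trail a s).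
Proof.
elim: s a => // i s IHs a; rewrite address_cons trail_cons simple_path_cons.
move=> /andP[/descend_children + s_addr]; rewrite mem_children => /andP[ea _].
have sp := IHs _ s_addr; rewrite ea sp andbT andTb inE negb_or; apply/andP; split.
  by apply: contraTneq ea => {1}->; rewrite e_irr.
have no_return : ohead (trail (descend a i) s) != Some a.2.
  case: s s_addr {IHs sp} => // j s.
  rewrite address_cons => /andP[/descend_children + _].
  by rewrite mem_children => /andP[].
apply: contraNN no_return => a_trail.
case/path.splitP: a_trail sp => p q /simple_path_prefix sp.
have := simple_path_closed e_acyclic sp; rewrite last_rcons size_rcons ea.
by case: (p) => [|y p'] /(_ isT) //=; rewrite eqxx.
Qed.

Lemma gdist_address a s t : address a s -> address a t ->
  gdist e (foldl descend a s).2 (foldl descend a t).2 = word_dist s t.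
Proof.
elim: s t a => [|i s IHs] [|j t] a s_addr t_addr.
1-3: by rewrite -!last_trail (gdist_disjoint_paths e_sym e_acyclic)
  ?trail_simple ?size_trail //; apply/hasPn.
rewrite [RHS]/=; case: eqVneq => [eq_ij | neq_ij].
  rewrite -eq_ij in t_addr *; case/andP: s_addr t_addr => _ s_addr /andP[_ t_addr].
  exact: IHs.
rewrite -!last_trail (gdist_disjoint_paths e_sym e_acyclic) ?trail_simple //.
  by rewrite !size_trail.
have disjoint_trails := simple_path_disjoint e_sym e_acyclic.
apply: disjoint_trails (trail_simple s_addr) (trail_simple t_addr) _.
case/andP: s_addr t_addr => lt_i _ /andP[lt_j _].
by rewrite /= nth_uniq ?enum_uniq.
Qed.

Lemma size_address a s : address a s -> size s < #|T|.
Proof.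
move=> /trail_simple/andP[_ /card_uniqP].
by rewrite /= size_trail => <-; apply: max_card.
Qed.

Lemma gdist_vertex : {in address (r, r) &, forall s t,
  gdist e (vertex s) (vertex t) = word_dist s t}.
Proof. by move=> s t; apply: gdist_address. Qed.

Lemma vertex_inj : {in address (r, r) &, injective vertex}.
Proof.
move=> s t s_addr t_addr eq_st; apply/eqP; rewrite -word_dist_eq0.
by rewrite -gdist_vertex // -eq_st gdist_vertex // word_dist_eq0.
Qed.

Lemma parent_trail s : (position s).1 \in r :: trail (r, r) s.
Proof.
case/lastP: s => [|s i]; first exact: mem_head.
rewrite /position foldl_rcons trail_rcons -rcons_cons mem_rcons inE.
by rewrite [X in X \in _]/= -last_trail mem_last orbT.
Qed.

Lemma trail_surj p : simple_path e r p ->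
  exists2 s, address (r, r) s & trail (r, r) s = p.
Proof.
elim/last_ind: p => [|p z IHp]; first by exists [::].
move=> spz; have sp : simple_path e r p.
  by apply: (@simple_path_prefix _ _ _ _ [:: z]); rewrite cats1.
have [s s_addr trailE] := IHp sp.
have z_child : z \in children (position s).
  move: spz; rewrite /simple_path rcons_path -rcons_cons rcons_uniq -trailE.
  move=> /andP[/andP[_ ez] /andP[z_new _]].
  rewrite mem_children /position -last_trail ez /=.
  by apply: contraNneq z_new => ->; apply: parent_trail.
exists (rcons s (index z (children (position s)))).
  by rewrite address_rcons s_addr index_mem.
by rewrite trail_rcons trailE /= nth_index.
Qed.

Lemma vertex_surj v : exists2 s, address (r, r) s & vertex s = v.
Proof.
have /connectP[p ep ->] := e_connected r v.
case/shortenP: ep => q eq uq _.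
have [|s s_addr <-] := @trail_surj q; first by rewrite /simple_path eq.
by exists s; rewrite // (last_trail (r, r)).
Qed.

Lemma degree_child a i : i < size (children a) ->
  degree e (descend a i).2 = (size (children (descend a i))).+1.
Proof.
move=> /descend_children; rewrite mem_children e_sym => /andP[e_parent _].
rewrite /degree (cardsD1 a.2) inE e_parent -cardE add1n; congr _.+1.
by apply: eq_card => z; rewrite !inE andbC.
Qed.

Lemma degree_root : degree e r = size (children (r, r)).
Proof.
rewrite -cardE; apply: eq_card => z; rewrite !inE /=.
by case: eqVneq => [-> | _]; rewrite ?e_irr ?andbT.
Qed.

End Addresses.

Fixpoint words (d l : nat) : seq (seq nat) :=
  if l is l'.+1 then [::] :: [seq i :: s | i <- iota 0 d, s <- words d l']
  else [:: [::]].

Lemma cons_words d l i s :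
  (i :: s \in words d l.+1) = (i < d) && (s \in words d l).
Proof.
rewrite /= inE /=; apply/allpairsP/andP => [[[j t] /= [jd tl [-> ->]]]|[id sl]].
  by rewrite mem_iota in jd.
by exists (i, s); rewrite mem_iota.
Qed.

Lemma mem_words d l s : (s \in words d l) = (size s <= l) && all (gtn d) s.
Proof.
elim: l s => [|l IHl] [|i s] //; rewrite cons_words IHl /=.
by rewrite ltnS andbCA.
Qed.

Lemma words_uniq d l : uniq (words d l).
Proof.
elim: l => //= l IHl; rewrite allpairs_uniq ?iota_uniq // ?andbT.
  by apply/allpairsP => -[[i s] []].
by move=> [i s] [j t] _ _ [-> ->].
Qed.

Section FullAryTree.

Variables (d l : nat) (T : finType) (e : rel T) (r : T).
Hypothesis full_tree : full_ary_tree d l e r.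

Let e_tree : tree e. Proof. by case: full_tree. Qed.

Lemma size_children_or_leaf s : address e (r, r) s ->
  size (children e (position e r s)) = d \/
  size (children e (position e r s)) = 0 /\ size s = l.
Proof.
case: full_tree => _ root_deg leaf_depth inner_deg.
case/lastP: s => [|s i] s_addr; first by left; rewrite -(degree_root r e_tree).
have := gdist_vertex e_tree (erefl : address e (r, r) [::]) s_addr.
have := trail_simple e_tree s_addr.
move: s_addr; rewrite address_rcons => /andP[_ lt_i].
rewrite trail_rcons /vertex /position foldl_rcons -/(position e r s).
set v := descend e _ i => /andP[_ v_new] v_depth.
have deg_v : degree e v.2 = (size (children e v)).+1 by apply: degree_child.
have v_neq_r : v.2 <> r.
  by move=> v_r; rewrite v_r cons_uniq mem_rcons mem_head in v_new.
case: (inner_deg _ v_neq_r) => [v_leaf | ]; last by rewrite deg_v => -[]; left.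
right; split; first by case: v_leaf; rewrite deg_v => _ [].
by rewrite -(leaf_depth _ v_leaf); apply: esym v_depth.
Qed.

Lemma size_children s : address e (r, r) s ->
  size (children e (position e r s)) = (size s < l) * d.
Proof.
move=> s_addr; have [size_d | [-> ->]] := size_children_or_leaf s_addr; last first.
  by rewrite ltnn.
have [|ge_l] := ltnP; first by rewrite mul1n.
(* Otherwise [s] could be extended for ever. *)
apply/eqP; rewrite size_d mul0n -leqn0 leqNgt; apply/negP => d_gt0.
have ext_addr n : address e (r, r) (s ++ nseq n 0).
  elim: n => [|n IHn]; first by rewrite cats0.
  rewrite -addn1 nseqD catA cats1 address_rcons IHn.
  case: n IHn => [|n] n_addr; first by rewrite cats0 -/(position e r s) size_d.
  case: (size_children_or_leaf n_addr) => [|[_]]; first by rewrite /position => ->.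
  by rewrite size_cat size_nseq; lia.
have := size_address e_tree (ext_addr #|T|).
by rewrite size_cat size_nseq; lia.
Qed.

Lemma address_words s : address e (r, r) s = (s \in words d l).
Proof.
elim/last_ind: s => [|s i IHs]; first by rewrite mem_words.
rewrite address_rcons -/(position e r s) mem_words size_rcons all_rcons.
have [s_addr | s_naddr] := boolP (address e (r, r) s).
  have := s_addr; rewrite IHs mem_words => /andP[_ ->].
  by rewrite size_children // andbT; case: (_ < l); rewrite ?mul1n.
symmetry; apply: contraNF s_naddr => /and3P[/ltnW le_l _ s_letters].
by rewrite IHs mem_words le_l.
Qed.

Lemma gdist_words : {in words d l &, forall s t,
  gdist e (vertex e r s) (vertex e r t) = word_dist s t}.
Proof. by move=> s t; rewrite -!address_words; apply: gdist_vertex. Qed.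

Lemma vertex_words_inj : {in words d l &, injective (vertex e r)}.
Proof. by move=> s t; rewrite -!address_words; apply: vertex_inj. Qed.

Lemma vertex_words_surj v : exists2 s, s \in words d l & vertex e r s = v.
Proof.
have [s s_addr <-] := vertex_surj r e_tree v.
by exists s; rewrite -?address_words.
Qed.

Lemma perm_enum_vertex : perm_eq (enum T) (map (vertex e r) (words d l)).
Proof.
apply: uniq_perm; first exact: enum_uniq.
  by rewrite map_inj_in_uniq ?words_uniq //; apply: vertex_words_inj.
move=> v; rewrite mem_enum inE; symmetry.
by have [s sw <-] := vertex_words_surj v; apply: map_f.
Qed.

End FullAryTree.

(** * Resolving sets of words *)

Lemma eq_sumD1 (I : finType) (f : I -> nat) i j :
  (\sum_(k | k != i) f k == \sum_(k | k != j) f k) = (f i == f j).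
Proof.
have split_sum m : \sum_k f k = f m + \sum_(k | k != m) f k by rewrite (bigD1 m).
by have := split_sum i; rewrite (split_sum j); lia.
Qed.

Section Profiles.

Variable d : nat.
Implicit Types (P Q : pred (seq nat)) (l n : nat) (s u v : seq nat).

Definition weight P l : nat := count P (words d l).

Definition level P l n : nat := count (fun s => P s && (size s == n)) (words d l).

Definition profile P l u n : nat :=
  count (fun s => P s && (word_dist u s == n)) (words d l).

Definition branch P (i : nat) : pred (seq nat) := fun s => P (i :: s).

Definition resolving l P : Prop :=
  {in words d l &, forall u v,
    ~~ P u -> ~~ P v -> profile P l u =1 profile P l v -> u = v}.

Definition level_resolving l P : Prop :=
  {in words d l &, forall u v, size u = size v ->
    ~~ P u -> ~~ P v -> profile P l u =1 profile P l v -> u = v}.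

Lemma resolving_level_resolving l P : resolving l P -> level_resolving l P.
Proof. by move=> rP u v uw vw _; apply: rP. Qed.

Lemma eq_resolving l P Q : {in words d l, P =1 Q} -> resolving l P -> resolving l Q.
Proof.
move=> eqPQ rP u v uw vw; rewrite -!eqPQ // => Pu Pv eq_uv; apply: rP => // n.
have eq_profile w : profile P l w n = profile Q l w n.
  by apply: eq_in_count => s /eqPQ ->.
by rewrite !eq_profile.
Qed.

Lemma count_words P l :
  count P (words d l.+1) = P [::] + \sum_(i < d) count (branch P i) (words d l).
Proof.
rewrite -(big_mkord xpredT (fun i => count (branch P i) (words d l))).
rewrite /= count_flatten -map_comp sumn_map /index_iota subn0.
by congr (_ + _); apply: eq_bigr => i _; apply: count_map.
Qed.

Lemma weight0 P : weight P 0 = P [::].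
Proof. exact: addn0. Qed.

Lemma weightS P l : weight P l.+1 = P [::] + \sum_(i < d) weight (branch P i) l.
Proof. exact: count_words. Qed.

Lemma level0 P l : level P l 0 = P [::].
Proof.
case: l => [|l]; first by rewrite /level /= andbT addn0.
rewrite /level count_words /= andbT big1 ?addn0 // => i _.
by rewrite -[RHS](count_pred0 (words d l)); apply: eq_count => s; apply: andbF.
Qed.

Lemma levelS P l n : level P l.+1 n.+1 = \sum_(i < d) level (branch P i) l n.
Proof. by rewrite /level count_words /= andbF. Qed.

Lemma profile_gt P l u n : size u + l < n -> profile P l u n = 0.
Proof.
move=> lt_n; apply/eqP; rewrite -leqn0 leqNgt -has_count; apply/hasPn => s.
rewrite mem_words => /andP[le_sl _]; rewrite negb_and orbC neq_ltn.
rewrite (leq_ltn_trans (word_dist_le u s)) //.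
by rewrite (leq_ltn_trans _ lt_n) // leq_add2l.
Qed.

Lemma profile_nil P l : profile P l [::] =1 level P l.
Proof. by []. Qed.

Lemma level_gt P l n : l < n -> level P l n = 0.
Proof. by move=> lt_ln; rewrite -profile_nil profile_gt. Qed.

Lemma profile_cons P l (i : 'I_d) u n :
  profile P l.+1 ((i : nat) :: u) n =
  (P [::] && ((size u).+1 == n)) + profile (branch P i) l u n +
  (size u + 2 <= n) * \sum_(j < d | j != i) level (branch P j) l (n - (size u + 2)).
Proof.
rewrite /profile count_words /= addn0 -addnA (bigD1 i) //= big_distrr /=.
congr (_ + (_ + _)).
  by apply: eq_count => s; rewrite /branch /= eqxx.
apply: eq_bigr => j; rewrite eq_sym -val_eqE => /negPf /= neq_ij.
case: (leqP (size u + 2) n) => n_u; rewrite ?mul1n ?mul0n.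
  by apply: eq_count => s; rewrite /branch neq_ij /=; congr (_ && _); lia.
rewrite -[RHS](count_pred0 (words d l)); apply: eq_count => s.
by rewrite /branch neq_ij /=; apply/negbTE; rewrite negb_and orbC; lia.
Qed.

Lemma level_resolving_branch l P i :
  level_resolving l.+1 P -> i < d -> level_resolving l (branch P i).
Proof.
move=> rP lt_id u v uw vw eq_size Pu Pv eq_uv; suff [] : i :: u = i :: v by [].
apply: rP; rewrite ?cons_words ?lt_id //=; first by rewrite eq_size.
by move=> n; rewrite !(profile_cons _ _ (Ordinal lt_id)) eq_size eq_uv.
Qed.

(* Vertices outside the branches of two siblings are equidistant from both. *)
Lemma siblings_eq_level l P i j : level_resolving l.+1 P ->
    i < d -> j < d -> i != j -> level (branch P i) l =1 level (branch P j) l ->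
  P [:: i] || P [:: j].
Proof.
move=> rP lt_id lt_jd neq_ij eq_ij; apply: contraNT neq_ij.
rewrite negb_or => /andP[Pi Pj]; suff [->] : [:: i] = [:: j] by [].
apply: rP; rewrite ?mem_words /= ?lt_id ?lt_jd // => n.
rewrite (profile_cons _ _ (Ordinal lt_id)) (profile_cons _ _ (Ordinal lt_jd)).
rewrite !profile_nil eq_ij; congr (_ + _ * _); apply/eqP.
by rewrite (eq_sumD1 (fun k : 'I_d => level (branch P k) l _)) eq_ij.
Qed.

Lemma level_resolving_leaf l P : 1 < d ->
  level_resolving l.+1 P -> 0 < level P l.+1 l.+1.
Proof.
move=> d_gt1; have d_gt0 := ltnW d_gt1.
elim: l P => [|l IHl] P rP; rewrite levelS (bigD1 (Ordinal d_gt0)) //= addn_gt0.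
  rewrite (bigD1 (Ordinal d_gt1)) //= !level0 addn_gt0.
  case P0: (branch P 0 [::]) => //; case P1: (branch P 1 [::]) => //.
  have eq_level : level (branch P 0) 0 =1 level (branch P 1) 0.
    by case=> [|n]; [rewrite !level0 P0 P1 | rewrite !level_gt].
  have := siblings_eq_level rP d_gt0 d_gt1 isT eq_level.
  by rewrite -![P [:: _]]/(branch P _ [::]) P0 P1.
by rewrite IHl //; apply: level_resolving_branch rP _.
Qed.

(* The largest distance from a vertex to a selected leaf determines its depth,
   since at least two branches of the root contain selected leaves. *)
Lemma level_resolving_resolving l P : 1 < d ->
  level_resolving l.+2 P -> resolving l.+2 P.
Proof.
move=> d_gt1 rP.
have leaves (i : 'I_d) : 0 < level (branch P i) l.+1 l.+1.
  by apply/level_resolving_leaf/(level_resolving_branch rP).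
have deeper u v : v \in words d l.+2 -> size u < size v ->
    profile P l.+2 u =1 profile P l.+2 v -> False.
  case: v => // b v; rewrite cons_words => /andP[bd _] lt_uv eq_uv.
  have [j neq_jb] : exists j : 'I_d, j != Ordinal bd.
    exists (if b == 0 then Ordinal d_gt1 else Ordinal (ltnW d_gt1)).
    by rewrite -val_eqE /=; case: (b).
  have := eq_uv (size v + 2 + l.+1).
  rewrite profile_gt; last by move: lt_uv => /=; lia.
  rewrite (profile_cons _ _ (Ordinal bd)) leq_addr addKn mul1n (bigD1 j) //=.
  by have := leaves j; lia.
move=> u v uw vw Pu Pv eq_uv.
have [lt_uv | lt_vu | eq_size] := ltngtP (size u) (size v).
- by case: (deeper u v).
- by case: (deeper v u).
- exact: rP.
Qed.

Definition join (F : nat -> pred (seq nat)) : pred (seq nat) :=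
  fun s => if s is i :: s' then F i s' else false.

(* The vertices of one branch see the leaves of the other branches at the
   maximal possible distance, so that two branches with different numbers of
   leaves are told apart. *)
Lemma level_resolving_join l (F : nat -> pred (seq nat)) :
    (forall i : 'I_d, level_resolving l (F i)) ->
    injective (fun i : 'I_d => level (F i) l l) ->
  level_resolving l.+1 (join F).
Proof.
move=> rF inj_leaves [|i u] [|j v] //; rewrite !cons_words.
move=> /andP[lt_i uw] /andP[lt_j vw] [eq_size] Pu Pv eq_uv.
suff eq_ij : i = j.
  rewrite -eq_ij in Pv eq_uv *; congr (_ :: _); apply: (rF (Ordinal lt_i)) => // n.
  have := eq_uv n; rewrite !(profile_cons _ _ (Ordinal lt_i)) eq_size.
  by move=> /addIn /addnI.
suff [] : Ordinal lt_i = Ordinal lt_j by [].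
apply/inj_leaves/eqP; rewrite -(eq_sumD1 (fun i : 'I_d => level (F i) l l)).
have lt_far : size v + l < size v + 2 + l by rewrite ltn_add2r -addn1 leq_add2l.
have := eq_uv (size v + 2 + l).
rewrite (profile_cons _ _ (Ordinal lt_i)) (profile_cons _ _ (Ordinal lt_j)) eq_size.
by rewrite !profile_gt ?eq_size // leq_addr addKn /= !mul1n => /eqP.
Qed.

(* Distances are at most [2 l]. *)
Definition distinct_profiles l P : bool :=
  uniq [seq mkseq (profile P l u) l.*2.+1 | u <- words d l & ~~ P u].

Lemma distinct_profiles_resolving l P : distinct_profiles l P -> resolving l P.
Proof.
rewrite /distinct_profiles.
set s := [seq _ <- _ | _] => /(uniqP [::]) uniq_s u v uw vw Pu Pv eq_uv.
have us : u \in s by rewrite mem_filter Pu.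
have vs : v \in s by rewrite mem_filter Pv.
rewrite -(nth_index [::] us) -(nth_index [::] vs); congr nth.
apply: uniq_s; rewrite ?inE ?size_map ?index_mem //.
by rewrite !(nth_map [::]) ?index_mem // !nth_index //; apply: eq_mkseq.
Qed.

Definition levels P l : seq nat := mkseq (level P l) l.+1.

Lemma nth_levels l P n : nth 0 (levels P l) n = level P l n.
Proof.
have [lt_ln | le_nl] := ltnP l n; last by rewrite nth_mkseq.
by rewrite nth_default ?size_mkseq // level_gt.
Qed.

Lemma levels_inj l P Q : levels P l = levels Q l -> level P l =1 level Q l.
Proof. by move=> eqPQ n; rewrite -!nth_levels eqPQ. Qed.

Lemma weight_levels l P : weight P l = sumn (levels P l).
Proof.
rewrite (sumn_map (level P l)) -[iota 0 l.+1]/(index_iota 0 l.+1).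
elim: l P => [|l IHl] P; first by rewrite weight0 big_nat1 level0.
rewrite weightS big_nat_recl // level0; congr (_ + _).
under [RHS]eq_bigr do rewrite levelS.
by rewrite exchange_big; apply: eq_bigr => i _; apply: IHl.
Qed.

Lemma weight_ge_iter l n k :
    (forall P, level_resolving l P -> n <= weight P l) ->
  forall P, level_resolving (k + l) P -> d ^ k * n <= weight P (k + l).
Proof.
move=> weight_ge; elim: k => [|k IHk] P rP; first by rewrite mul1n weight_ge.
rewrite weightS expnS -mulnA; apply: leq_trans (leq_addl _ _).
rewrite -[d in d * _]card_ord -sum_nat_const; apply: leq_sum => i _.
by apply/IHk/(level_resolving_branch rP).
Qed.

Definition leaf_count_attained l n a : Prop :=
  exists P, [/\ level_resolving l P, weight P l = n & level P l l = a].

Lemma leaf_count_attained_join l n (a : 'I_d -> nat) : injective a ->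
    (forall i, leaf_count_attained l n (a i)) ->
  leaf_count_attained l.+1 (d * n) (\sum_i a i).
Proof.
move=> inj_a /fin_all_exists[P /= attP].
pose F i := if insub i is Some j then P j else pred0.
have FE (i : 'I_d) : F i = P i by rewrite /F valK.
have branchE (i : 'I_d) : branch (join F) i = P i by rewrite -FE.
exists (join F); split.
- apply: level_resolving_join => [i | i j]; rewrite !FE; first by case: (attP i).
  by have [[_ _ ->] [_ _ ->]] := (attP i, attP j); apply: inj_a.
- rewrite weightS -[d in d * n]card_ord -sum_nat_const; apply: eq_bigr => i _.
  by rewrite branchE; case: (attP i).
- by rewrite levelS; apply: eq_bigr => i _; rewrite branchE; case: (attP i).
Qed.

Lemma sum_bump h m : \sum_(i < m) bump h i = \sum_(i < m) i + (m - h).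
Proof.
elim: m => [|m IHm]; first by rewrite !big_ord0.
by rewrite !big_ord_recr /= IHm /bump; case: leqP => h_m /=; lia.
Qed.

Definition consecutive_leaf_counts l n : Prop :=
  exists a, forall i, i <= d -> leaf_count_attained l n (a + i).

(* Omitting one of [d + 1] consecutive leaf counts in turn, the sums of the
   others are again [d + 1] consecutive numbers. *)
Lemma consecutive_leaf_countsS l n :
  consecutive_leaf_counts l n -> consecutive_leaf_counts l.+1 (d * n).
Proof.
move=> [a att_a]; exists (d * a + \sum_(j < d) j) => i le_id.
have -> : d * a + \sum_(j < d) j + i = \sum_(j < d) (a + bump (d - i) j).
  by rewrite big_split /= sum_bump sum_nat_const card_ord subKn // addnA.
apply: leaf_count_attained_join => [j k | j].
  by move=> /addnI/(can_inj (bumpK _))/val_inj.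
by apply: att_a; apply: leq_trans (leq_add (leq_b1 _) (leqnn j)) (ltn_ord j).
Qed.

Lemma consecutive_leaf_counts_iter l n k :
  consecutive_leaf_counts l n -> consecutive_leaf_counts (k + l) (d ^ k * n).
Proof.
move=> att; elim: k => [|k IHk]; first by rewrite mul1n.
by rewrite expnS -mulnA; apply: consecutive_leaf_countsS.
Qed.

End Profiles.

(** * Full binary trees *)

Section BinaryLowerBound.

Implicit Types (P : pred (seq nat)) (l : nat).

Lemma levels_depth0 P : levels 2 P 0 = [:: P [::] : nat].
Proof. by congr [:: _]; apply: level0. Qed.

Lemma levels_binaryS P l :
  levels 2 P l.+1 = (P [::] : nat) ::
    [seq x.1 + x.2 | x <- zip (levels 2 (branch P 0) l) (levels 2 (branch P 1) l)].
Proof.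
have iotaS : iota 0 l.+2 = 0 :: map succn (iota 0 l.+1).
  exact: (congr1 (cons 0) (iotaDl 1 0 l.+1)).
rewrite {1}/levels /mkseq iotaS map_cons level0 zip_map -!map_comp.
congr (_ :: _); apply: eq_map => n.
by rewrite /comp levelS !big_ord_recl big_ord0 addn0.
Qed.

Lemma siblings_eq_levels P l : level_resolving 2 l.+1 P ->
  (levels 2 (branch P 0) l == levels 2 (branch P 1) l) ==>
  (0 < head 0 (levels 2 (branch P 0) l)).
Proof.
move=> rP; apply/implyP => /eqP/levels_inj eq_level.
have := siblings_eq_level (i := 0) (j := 1) rP isT isT isT eq_level.
rewrite -nth0 nth_levels; have := eq_level 0; rewrite !level0 /branch /=.
by do 2!case: (P _).
Qed.

Lemma levels_depth1 P : level_resolving 2 1 P ->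
  levels 2 P 1 \in [:: [:: 0; 1]; [:: 0; 2]; [:: 1; 1]; [:: 1; 2]].
Proof.
move=> /siblings_eq_levels; rewrite (levels_binaryS P) !levels_depth0.
by case: (P [::]) (branch P 0 _) (branch P 1 _) => -[] [].
Qed.

Lemma weight_binaryS P l : weight 2 P l.+1 =
  P [::] + weight 2 (branch P 0) l + weight 2 (branch P 1) l.
Proof. by rewrite weightS !big_ord_recl big_ord0 addn0 addnA. Qed.

Lemma weight_ge_depth1 P : level_resolving 2 1 P -> 1 <= weight 2 P 1.
Proof. by move=> /levels_depth1; rewrite weight_levels !inE => /or4P[]/eqP->. Qed.

Lemma weight_ge_depth2 P : level_resolving 2 2 P -> 3 <= weight 2 P 2 /\
  (weight 2 P 2 = 3 -> levels 2 P 2 \in [:: [:: 0; 1; 2]; [:: 0; 0; 3]]).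
Proof.
move=> rP; have := siblings_eq_levels rP.
have := levels_depth1 (level_resolving_branch (i := 0) rP isT).
have := levels_depth1 (level_resolving_branch (i := 1) rP isT).
rewrite weight_levels (levels_binaryS P) !inE.
by case/or4P=> /eqP-> /or4P[]/eqP->; case: (P [::]).
Qed.

Lemma weight_ge_depth3 P : level_resolving 2 3 P -> 6 <= weight 2 P 3 /\
  (weight 2 P 3 = 6 -> levels 2 P 3 = [:: 0; 0; 1; 5]).
Proof.
move=> rP; rewrite (levels_binaryS P) weight_binaryS.
have [ge0 levels0] := weight_ge_depth2 (level_resolving_branch (i := 0) rP isT).
have [ge1 levels1] := weight_ge_depth2 (level_resolving_branch (i := 1) rP isT).
split=> [|weight6]; first by lia.
have -> : P [::] = false by lia.
have := siblings_eq_levels rP.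
have /levels0 : weight 2 (branch P 0) 2 = 3 by lia.
have /levels1 : weight 2 (branch P 1) 2 = 3 by lia.
by rewrite !inE => /orP[]/eqP-> /orP[]/eqP->.
Qed.

Lemma weight_ge_depth4 P : level_resolving 2 4 P -> 13 <= weight 2 P 4.
Proof.
move=> rP; rewrite weight_binaryS.
have [ge0 levels0] := weight_ge_depth3 (level_resolving_branch (i := 0) rP isT).
have [ge1 levels1] := weight_ge_depth3 (level_resolving_branch (i := 1) rP isT).
rewrite ltnNge; apply/negP => le12.
have := siblings_eq_levels rP.
have /levels0-> : weight 2 (branch P 0) 3 = 6 by lia.
by have /levels1-> : weight 2 (branch P 1) 3 = 6 by lia.
Qed.

End BinaryLowerBound.

Lemma consecutive_leaf_counts_depth4 : consecutive_leaf_counts 2 4 13.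
Proof.
have attained (ws : seq (seq nat)) a :
    [&& distinct_profiles 2 4 [in ws], weight 2 [in ws] 4 == 13
      & level 2 [in ws] 4 4 == a] -> leaf_count_attained 2 4 13 a.
  move=> /and3P[/distinct_profiles_resolving res_ws /eqP weight_ws /eqP level_ws].
  by exists [in ws]; split=> //; apply: resolving_level_resolving.
exists 9 => -[|[|[|]]] // _.
- by apply: (attained [:: [:: 1; 0]; [:: 0; 0; 0]; [:: 1; 0; 0]; [:: 1; 1; 0];
    [:: 0; 0; 0; 0]; [:: 0; 0; 1; 0]; [:: 0; 1; 0; 0]; [:: 0; 1; 0; 1];
    [:: 0; 1; 1; 0]; [:: 1; 0; 0; 0]; [:: 1; 0; 1; 0]; [:: 1; 1; 0; 0];
    [:: 1; 1; 1; 0]]); vm_compute.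
- by apply: (attained [:: [:: 1]; [:: 0; 0; 0]; [:: 1; 0; 0]; [:: 0; 0; 0; 0];
    [:: 0; 0; 1; 0]; [:: 0; 1; 0; 0]; [:: 0; 1; 0; 1]; [:: 0; 1; 1; 0];
    [:: 1; 0; 0; 0]; [:: 1; 0; 1; 0]; [:: 1; 1; 0; 0]; [:: 1; 1; 0; 1];
    [:: 1; 1; 1; 0]]); vm_compute.
- by apply: (attained [:: [:: 0; 0; 0]; [:: 1; 0; 0]; [:: 0; 0; 0; 0];
    [:: 0; 0; 1; 0]; [:: 0; 1; 0; 0]; [:: 0; 1; 0; 1]; [:: 0; 1; 1; 0];
    [:: 1; 0; 0; 0]; [:: 1; 0; 0; 1]; [:: 1; 0; 1; 0]; [:: 1; 1; 0; 0];
    [:: 1; 1; 0; 1]; [:: 1; 1; 1; 0]]); vm_compute.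
Qed.

(** * The outer multiset dimension *)

Section Dimension.

Variables (d l : nat) (T : finType) (e : rel T) (r : T).
Hypothesis full_tree : full_ary_tree d l e r.

Implicit Types (S : {set T}) (P : pred (seq nat)).

Definition selected_words S : pred (seq nat) := fun s => vertex e r s \in S.

Lemma count_enum S (Q : pred T) :
  count Q (enum S) =
  count (fun s => selected_words S s && Q (vertex e r s)) (words d l).
Proof.
have -> : enum S = [seq v <- enum T | v \in S] by rewrite enumT.
rewrite count_filter (permP (perm_enum_vertex full_tree)) count_map.
by apply: eq_count => s; rewrite /= andbC.
Qed.

Lemma card_weight S : #|S| = weight d (selected_words S) l.
Proof.
rewrite cardE -(count_predT (enum S)) count_enum.
by apply: eq_count => s; rewrite andbT.
Qed.

Lemma mrep_profile S s : s \in words d l ->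
  mrep e S (vertex e r s) =1 profile d (selected_words S) l s.
Proof.
move=> sw n; rewrite /mrep mset_seqE count_map count_enum.
by apply: eq_in_count => t tw /=; rewrite (gdist_words full_tree).
Qed.

Lemma outer_ms_resolvingE S :
  outer_ms_resolving e S <-> resolving d l (selected_words S).
Proof.
split=> [rS s t sw tw Ss St eq_st | rS].
  apply: (vertex_words_inj full_tree sw tw); apply/eqP/contraT => neq_st.
  have /forallP/(_ (vertex e r s))/forallP/(_ (vertex e r t)) := rS.
  rewrite [_ \notin S]Ss [_ \notin S]St neq_st => /eqP[]; apply/msetP => n.
  by rewrite !mrep_profile.
apply/forallP => u; apply/forallP => v; apply/implyP => /and3P[Su Sv].
have [s sw sE] := vertex_words_surj full_tree u.
have [t tw tE] := vertex_words_surj full_tree v.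
rewrite -sE -tE in Su Sv *; apply: contraNneq => eq_st; apply/eqP; congr vertex.
by apply: rS => // n; rewrite -!mrep_profile // eq_st.
Qed.

Lemma dim_ms_words n :
    (forall P, resolving d l P -> n <= weight d P l) ->
    (exists2 P, resolving d l P & weight d P l = n) ->
  dim_ms e = n.
Proof.
move=> weight_ge [P rP weightP]; rewrite /dim_ms; case: arg_minnP => [|S rS minS].
  by apply/forallP => u; apply/forallP => v; rewrite inE.
apply/eqP; rewrite eqn_leq andbC card_weight weight_ge /=; last first.
  exact/outer_ms_resolvingE.
pose SP := [set v in map (vertex e r) (filter P (words d l))].
have SPE : {in words d l, P =1 selected_words SP}.
  move=> s sw; rewrite /selected_words inE; apply/idP/mapP => [Ps | [t]].
    by exists s; rewrite // mem_filter Ps.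
  by rewrite mem_filter => /andP[Pt tw] /(vertex_words_inj full_tree sw tw)->.
have cardSP : weight d P l = #|SP| by rewrite card_weight; apply: eq_in_count.
rewrite -card_weight -weightP cardSP.
by apply: minS; apply/outer_ms_resolvingE; apply: eq_resolving rP.
Qed.

End Dimension.

Lemma dim_ms_full_binary_tree_ge4 (k : nat) (T : finType) (e : rel T) (r : T) :
  full_ary_tree 2 (k + 4) e r -> dim_ms e = 2 ^ k * 13.
Proof.
move=> full_tree.
apply: (dim_ms_words full_tree) => [P /resolving_level_resolving|].
  exact: (weight_ge_iter weight_ge_depth4).
have [a /(_ 0 isT)[P [rP weightP _]]] :=
  consecutive_leaf_counts_iter k consecutive_leaf_counts_depth4.
exists P => //; rewrite !addnS in rP *.
exact: level_resolving_resolving rP.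
Qed.

Theorem corollary5p4 (l : nat) (hl : 1 <= l)
    (T : finType) (e : rel T) (r : T) (hT : full_ary_tree 2 l e r) :
  dim_ms e = match l with
             | 1 => 1
             | 2 => 3
             | 3 => 6
             | 4 => 13
             | _ => 2 ^ (l - 4) * 13
             end.
Proof.
case: l hl hT => [//|[|[|[|k]]]] _ hT.
- apply: (dim_ms_words hT) => [P /resolving_level_resolving|].
    exact: weight_ge_depth1.
  exists [in [:: [:: 0]]] => //.
  by apply: distinct_profiles_resolving; vm_compute.
- apply: (dim_ms_words hT) => [P /resolving_level_resolving|].
    by case/weight_ge_depth2.
  exists [in [:: [:: 0]; [:: 0; 0]; [:: 1; 0]]] => //.
  by apply: distinct_profiles_resolving; vm_compute.
- apply: (dim_ms_words hT) => [P /resolving_level_resolving|].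
    by case/weight_ge_depth3.
  exists [in [:: [:: 0; 0]; [:: 0; 0; 0]; [:: 0; 1; 0];
                 [:: 1; 0; 0]; [:: 1; 0; 1]; [:: 1; 1; 0]]] => //.
  by apply: distinct_profiles_resolving; vm_compute.
- rewrite -addn4 in hT; rewrite (dim_ms_full_binary_tree_ge4 hT).
  by case: k {hT} => // k; rewrite -[k.+1.+4]addn4 addnK.
Qed.
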